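(* Let $f(x)=\max_{i=1,\dots,m}\{a_i^Tx+b_i\}$ on $\mathbb{R}^d$, with $a_i\in\mathbb{R}^d$ and database $D=(b_1,\dots,b_m)\in\mathbb{R}^m$, let $x_{\mathrm{opt}}=x_{\mathrm{opt}}(D)$ be the chosen minimizer of $f$ over $\mathcal{P}$, and let $G=\max_i\|a_i\|_2$. Let $\epsilon>0$ and let $M_S(D)=x_{\mathrm{opt}}(D)+w_S$, where $w_S\in\mathbb{R}^d$ is a random vector with probability density proportional to $\exp\!\left(-\epsilon\|w_S\|_2/(\sqrt{d}\,\Delta)\right)$ and $\Delta$ is the sensitivity of the optimal solution. Then $$\mathbb{E}\big[f(M_S(D))-f(x_{\mathrm{opt}})\big]\le \frac{G\,d^{3/2}\,\Delta}{\epsilon}.$$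
   Context: $\mathcal{P}\subseteq\mathbb{R}^d$ is a fixed nonempty convex polytope defined by linear inequalities; the vectors $a_1,\dots,a_m$ and $\mathcal{P}$ are public and fixed, and only $D=(b_1,\dots,b_m)$ varies. For each database $D$, $x_{\mathrm{opt}}(D)\in\mathcal{P}$ denotes a (fixed choice of) optimal solution of $\min_{x\in\mathcal{P}}\max_i\{a_i^Tx+b_i\}$, assumed to exist. Two databases $D=(b_i)$ and $D'=(b_i')$ are adjacent, $\mathrm{Adj}(D,D')$, iff $\max_i|b_i-b_i'|\le b_{\max}$, where $b_{\max}>0$ is a given constant. The sensitivity of the optimal solution is $\Delta=\sup_{D,D':\,\mathrm{Adj}(D,D')}\|x_{\mathrm{opt}}(D)-x_{\mathrm{opt}}(D')\|_2$, assumed to satisfy $0<\Delta<\infty$. *)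

(* Defs.v *)
From HB Require Import structures.
From mathcomp Require Import all_boot all_order all_algebra.
From mathcomp Require Import all_classical all_reals all_analysis.

Set Implicit Arguments.
Unset Strict Implicit.
Unset Printing Implicit Defensive.

Import Order.TTheory GRing.Theory Num.Theory.
Import numFieldNormedType.Exports.

Local Open Scope classical_set_scope.
Local Open Scope ring_scope.

(* R^n is 'rV[R]_n with the sigma-algebra generated by the coordinates, as the
   library does for n.-tuple T; this is the Borel sigma-algebra of R^n. *)
Definition rV_display : measure_display.
Proof. exact: default_measure_display. Qed.

Section measurable_rV.
Context (R : realType) (n : nat).

Definition rV_coord (i : 'I_n) (v : 'rV[R]_n) : R := v 0 i.

Let rV_set0 : g_sigma_preimage rV_coord set0.
Proof. exact: sigma_algebra0. Qed.

Let rV_setC A : g_sigma_preimage rV_coord A -> g_sigma_preimage rV_coord (~` A).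
Proof. exact: sigma_algebraC. Qed.

Let rV_bigcup (F : (set 'rV[R]_n)^nat) :
  (forall i, g_sigma_preimage rV_coord (F i)) ->
  g_sigma_preimage rV_coord (\bigcup_i (F i)).
Proof. exact: sigma_algebra_bigcup. Qed.

HB.instance Definition _ := @isMeasurable.Build rV_display 'rV[R]_n
  (g_sigma_preimage rV_coord) rV_set0 rV_setC rV_bigcup.

Lemma measurable_rV_coord (i : 'I_n) :
  measurable_fun [set: 'rV[R]_n] (rV_coord i).
Proof.
move=> _ Y mY; rewrite setTI; apply: sub_sigma_algebra => /=.
rewrite -bigcup_seq/=; exists i => /=; first by rewrite mem_index_enum.
by exists Y => //; rewrite setTI.
Qed.

Lemma measurable_fun_rV d (T : measurableType d) (f : T -> 'rV[R]_n) :
  (forall i, measurable_fun [set: T] (rV_coord i \o f)) ->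
  measurable_fun [set: T] f.
Proof.
move=> mf; suff : g_sigma_preimage (fun i => rV_coord i \o f) `<=` measurable.
  rewrite g_sigma_preimage_comp => h _ A mA; apply: h; exists A => //.
apply: smallest_sub; first exact: sigma_algebra_measurable.
by rewrite -bigcup_seq/=; apply: bigcup_sub => i _ _ [B mB <-]; exact: mf.
Qed.

End measurable_rV.

Section lebesgue_measure_rV.
Context (R : realType).

Definition rV_cons n (p : R * 'rV[R]_n) : 'rV[R]_n.+1 :=
  \row_i if unlift ord0 i is Some j then p.2 0 j else p.1.

Lemma rV_cons0 n p : @rV_cons n p 0 ord0 = p.1.
Proof. by rewrite mxE unlift_none. Qed.

Lemma rV_consS n p (i : 'I_n) : rV_cons p 0 (lift ord0 i) = p.2 0 i.
Proof. by rewrite mxE liftK. Qed.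

Lemma rV_cons_split n (v : 'rV[R]_n.+1) :
  rV_cons (v 0 ord0, \row_i v 0 (lift ord0 i)) = v.
Proof.
apply/rowP => i; case: (unliftP ord0 i) => [j ->|->].
  by rewrite rV_consS mxE.
by rewrite rV_cons0.
Qed.

Lemma measurable_rV_cons n : measurable_fun setT (@rV_cons n).
Proof.
apply: measurable_fun_rV => i; case: (unliftP ord0 i) => [j ->|->].
  rewrite (_ : _ \o _ = @rV_coord R n j \o snd).
    by apply: measurableT_comp => //; exact: measurable_rV_coord.
  by apply/funext => p; exact: rV_consS.
rewrite (_ : _ \o _ = fst)//.
by apply/funext => p; exact: rV_cons0.
Qed.

Lemma measurable_rV_uncons n :
  measurable_fun setT (fun v : 'rV[R]_n.+1 => \row_i v 0 (lift ord0 i)).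
Proof.
apply: measurable_fun_rV => i.
rewrite (_ : _ \o _ = rV_coord (lift ord0 i)); first exact: measurable_rV_coord.
by apply/funext => v; rewrite /rV_coord/= mxE.
Qed.

Section step.
Local Open Scope ereal_scope.
Variables (n : nat) (mu : {sigma_finite_measure set 'rV[R]_n -> \bar R}).

Definition lebesgue_rV_step : set 'rV[R]_n.+1 -> \bar R :=
  pushforward (lebesgue_measure \x mu) (@rV_cons n).

Let step0 : lebesgue_rV_step set0 = 0.
Proof. by rewrite /lebesgue_rV_step /pushforward preimage_set0 measure0. Qed.

Let step_ge0 A : 0 <= lebesgue_rV_step A.
Proof. by rewrite /lebesgue_rV_step /pushforward measure_ge0. Qed.

Let step_sigma_additive : semi_sigma_additive lebesgue_rV_step.
Proof.
move=> F mF tF mUF; rewrite /lebesgue_rV_step /pushforward preimage_bigcup.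
apply: measure_semi_sigma_additive.
- by move=> k; rewrite -[X in measurable X]setTI; exact: measurable_rV_cons.
- apply/trivIsetP => /= i j _ _ ij; rewrite -preimage_setI.
  by move/trivIsetP : tF => /(_ _ _ _ _ ij) ->//; rewrite preimage_set0.
- by rewrite -preimage_bigcup -[X in measurable X]setTI; exact: measurable_rV_cons.
Qed.

HB.instance Definition _ := isMeasure.Build _ _ _ lebesgue_rV_step
  step0 step_ge0 step_sigma_additive.

Lemma lebesgue_rV_stepX (A : set R) (B : set 'rV[R]_n) :
  measurable A -> measurable B ->
  lebesgue_rV_step [set v | A (v 0%R ord0) /\ B (\row_i v 0%R (lift ord0 i))%R] =
  lebesgue_measure A * mu B.
Proof.
move=> mA mB; rewrite /lebesgue_rV_step /pushforward -product_measure1E//.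
congr product_measure1; apply/seteqP; split => -[x v] /=.
  rewrite rV_cons0 /= => -[? h]; split => //; move: h; congr B.
  by apply/rowP => i; rewrite mxE rV_consS.
move=> [? h]; rewrite rV_cons0; split => //; move: h; congr B.
by apply/rowP => i; rewrite mxE rV_consS.
Qed.

Let step_sigma_finite : sigma_finite setT lebesgue_rV_step.
Proof.
have /sigma_finiteP[F [TF ndF Foo]] := sigma_finiteT (@lebesgue_measure R).
have /sigma_finiteP[G [TG ndG Goo]] := sigma_finiteT mu.
exists (fun k => [set v : 'rV[R]_n.+1 | F k (v 0%R ord0) /\ G k (\row_i v 0%R (lift ord0 i))%R]).
  apply/esym; rewrite -subTset => v _.
  have : [set: R] (v 0%R ord0) by [].
  have : [set: 'rV[R]_n] (\row_i v 0%R (lift ord0 i))%R by [].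
  rewrite TF TG => -[k _ Gk] [j _ Fj]; exists (maxn j k) => //; split.
    by move: Fj; exact/subsetPset/ndF/leq_maxl.
  by move: Gk; exact/subsetPset/ndG/leq_maxr.
move=> k; have [mF Fk] := Foo k; have [mG Gk] := Goo k; split.
  apply: measurableI.
    rewrite -[X in measurable X]setTI.
    exact: (@measurable_rV_coord R _ ord0).
  by rewrite -[X in measurable X]setTI; exact: measurable_rV_uncons.
by rewrite lebesgue_rV_stepX// lte_mul_pinfty// ge0_fin_numE.
Qed.

HB.instance Definition _ := Measure_isSigmaFinite.Build _ _ _ lebesgue_rV_step
  step_sigma_finite.

End step.

(* Lebesgue measure on R^n as the n-fold product of the one on R; R^0 is a
   point of mass 1. *)
Fixpoint lebesgue_rV n : {sigma_finite_measure set 'rV[R]_n -> \bar R} :=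
  if n is k.+1 then lebesgue_rV_step (lebesgue_rV k) else \d_(0 : 'rV[R]_0).

Lemma lebesgue_rV_box n (A : 'I_n -> set R) :
  (forall i, measurable (A i)) ->
  lebesgue_rV n [set v | forall i, A i (v 0 i)] =
  (\prod_(i < n) lebesgue_measure (A i))%E.
Proof.
elim: n A => [|n IH] A mA.
  by rewrite big_ord0 /= diracE mem_set// => -[].
have mB : measurable [set v : 'rV[R]_n | forall i, A (lift ord0 i) (v 0 i)].
  rewrite (_ : mkset _ =
      \bigcap_(i in [set: 'I_n]) (rV_coord i @^-1` A (lift ord0 i))).
    apply: fin_bigcap_measurable => // i _.
    by rewrite -[X in measurable X]setTI; exact: measurable_rV_coord.
  by apply/seteqP; split => v /= h i; [move=> _; exact: h|exact: h].
rewrite big_ord_recl -(IH (A \o lift ord0))//=.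
rewrite -(lebesgue_rV_stepX _ _ mB)//.
congr (lebesgue_rV_step _ _); apply/seteqP; split => v /=.
  by move=> h; split => // i; rewrite mxE.
move=> [h0 h] i; case: (unliftP ord0 i) => [j ->|->//].
by have := h j; rewrite mxE.
Qed.

End lebesgue_measure_rV.

Section maxaffine.
Context (R : realType).

Definition dotp d (x y : 'rV[R]_d) : R := \sum_(i < d) x 0 i * y 0 i.

(* `|x| on 'rV[R]_d is the sup norm in the library. *)
Definition norm2 d (x : 'rV[R]_d) : R := Num.sqrt (dotp x x).

Definition fmax m (F : 'I_m.+1 -> R) : R := \big[Num.max/F ord0]_(i < m.+1) F i.

Definition maxaffine d m (a : 'I_m.+1 -> 'rV[R]_d) (b : 'rV[R]_m.+1)
    (x : 'rV[R]_d) : R :=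
  fmax (fun i => dotp (a i) x + b 0 i).

(* Boundedness is not required. *)
Definition polytope d (P : set 'rV[R]_d) : Prop :=
  exists (k : nat) (c : 'I_k -> 'rV[R]_d) (e : 'I_k -> R),
    P = [set x | forall j, dotp (c j) x <= e j].

Definition minimizer d (P : set 'rV[R]_d) (f : 'rV[R]_d -> R) (x : 'rV[R]_d) :
  Prop := P x /\ forall y, P y -> f x <= f y.

Definition adj m (bmax : R) (b b' : 'rV[R]_m.+1) : Prop :=
  fmax (fun i => `|b 0 i - b' 0 i|) <= bmax.

Definition sensitivity d m (bmax : R) (xopt : 'rV[R]_m.+1 -> 'rV[R]_d) :
    \bar R :=
  ereal_sup [set r | exists b b' : 'rV[R]_m.+1,
    adj bmax b b' /\ r = (norm2 (xopt b - xopt b'))%:E].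

(* The factor c is forced to be the inverse of the integral of g. *)
Definition density_proportional_to d (disp : measure_display)
    (T : measurableType disp) (Pr : probability T R)
    (w : {RV Pr >-> 'rV[R]_d}) (g : 'rV[R]_d -> R) : Prop :=
  exists2 c : R, 0 < c & forall A : set 'rV[R]_d, measurable A ->
    distribution Pr w A = (\int[lebesgue_rV R d]_(x in A) (c * g x)%:E)%E.

End maxaffine.

(* Main.v *)
(* Since f is Lipschitz with constant G, it suffices to bound E|w| by d / lam for
   a density proportional to exp(-lam |x|), lam = eps / (sqrt d Delta). Let I and J
   be the Lebesgue integrals of exp(-lam |x|) and |x| exp(-lam |x|). For 0 < e < 1,
   exp(v) >= 1 + v at v = lam e |x| shows that I + lam e J is at most the integral
   of exp(-lam |(1 - e) x|), which is (1 - e)^-d I by scaling. Bernoulli's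
   inequality then gives lam J <= d I + e d lam J, and e -> 0 gives lam J <= d I. *)

Require Import Defs.
From HB Require Import structures.
From mathcomp Require Import all_boot all_order all_algebra.
From mathcomp Require Import all_classical all_reals all_analysis.
From mathcomp Require Import measurable_realfun ring lra.

Import Order.TTheory GRing.Theory Num.Theory.
Import numFieldNormedType.Exports.

Local Open Scope classical_set_scope.
Local Open Scope ring_scope.

(** * Euclidean norm and the Lipschitz bound for a maximum of affine functions *)

Section euclidean.
Context {R : realType}.

Lemma dotp_ge0 d (x : 'rV[R]_d) : 0 <= dotp x x.
Proof. by apply: sumr_ge0 => i _; rewrite -expr2 sqr_ge0. Qed.

Lemma norm2_ge0 d (x : 'rV[R]_d) : 0 <= norm2 x.
Proof. exact: sqrtr_ge0. Qed.

Lemma dotpDr d (a x y : 'rV[R]_d) : dotp a (x + y) = dotp a x + dotp a y.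
Proof. by rewrite -big_split; apply: eq_bigr => i _; rewrite mxE mulrDr. Qed.

Lemma norm2Z d s (x : 'rV[R]_d) : 0 <= s -> norm2 (s *: x) = s * norm2 x.
Proof.
move=> s0; rewrite /norm2 (_ : dotp _ _ = s ^+ 2 * dotp x x).
  by rewrite sqrtrM ?sqr_ge0// sqrtr_sqr ger0_norm.
by rewrite mulr_sumr; apply: eq_bigr => i _; rewrite !mxE; ring.
Qed.

(** Cauchy-Schwarz, from the nonnegativity in t of the quadratic |x - t y|^2. *)
Lemma dotp_le_norm2 d (x y : 'rV[R]_d) : dotp x y <= norm2 x * norm2 y.
Proof.
have [->|xy0] := eqVneq (dotp x y) 0; first by rewrite mulr_ge0 ?norm2_ge0.
have quad t : 0 <= dotp x x - (t * dotp x y) *+ 2 + t ^+ 2 * dotp y y.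
  rewrite /dotp !mulr_sumr -sumrMnl -sumrB -big_split/=; apply: sumr_ge0 => i _.
  rewrite (_ : _ + _ = (x 0 i - t * y 0 i) ^+ 2) ?sqr_ge0//; ring.
have [yy0|yyN0] := eqVneq (dotp y y) 0.
  (* Here the quadratic is affine in t with nonzero slope; at this t it equals -[dotp x x] - 2,
     which is negative. *)
  have := quad ((dotp x x + 1) / dotp x y).
  rewrite yy0 divfK// mulr0; have := dotp_ge0 _ x; lra.
have yy_gt0 : 0 < dotp y y by rewrite lt_neqAle eq_sym yyN0 dotp_ge0.
rewrite /norm2 -sqrtrM ?dotp_ge0// (le_trans (ler_norm _))// -sqrtr_sqr.
rewrite ler_wsqrtr// -subr_ge0.
(* This t minimizes the quadratic; multiplying the minimum by [dotp y y] gives the claim. *)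
have := quad (dotp x y / dotp y y); rewrite -(pmulr_rge0 _ yy_gt0).
by congr (_ <= _); field.
Qed.

Lemma le_fmax m (F : 'I_m.+1 -> R) i : F i <= fmax F.
Proof. exact: le_bigmax. Qed.

Lemma fmax_le m (F : 'I_m.+1 -> R) c : (forall i, F i <= c) -> fmax F <= c.
Proof. by move=> Fc; apply: bigmax_le. Qed.

(** Each affine piece grows by [dotp (a i) w], which Cauchy-Schwarz bounds by G |w| whichever piece
    attains the maximum. *)
Lemma maxaffine_lip d m (a : 'I_m.+1 -> 'rV[R]_d) b x w :
  maxaffine a b (x + w) - maxaffine a b x <= fmax (fun i => norm2 (a i)) * norm2 w.
Proof.
rewrite lerBlDl; apply: fmax_le => i.
rewrite dotpDr addrAC lerD ?(le_fmax _ (fun i => dotp (a i) x + b 0 i))//.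
by rewrite (le_trans (dotp_le_norm2 _ _ _))// ler_wpM2r ?norm2_ge0//
  (le_fmax _ (fun i => norm2 (a i))).
Qed.

End euclidean.

(** * Measurability of norms, dilations and maxima of affine functions *)

Section measurability.
Context {R : realType} {disp : measure_display} {T : measurableType disp}.

Lemma measurable_rV_coordE d (f : T -> 'rV[R]_d) i :
  measurable_fun setT f -> measurable_fun setT (fun t => f t 0 i).
Proof. by move=> mf; exact: measurableT_comp (measurable_rV_coord i) mf. Qed.

Lemma measurable_dotp d (f g : T -> 'rV[R]_d) : measurable_fun setT f ->
  measurable_fun setT g -> measurable_fun setT (fun t => dotp (f t) (g t)).
Proof.
move=> mf mg; apply: measurable_sum => i.
by apply: measurable_funM; exact: measurable_rV_coordE.
Qed.

Lemma measurable_norm2 d (f : T -> 'rV[R]_d) : measurable_fun setT f ->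
  measurable_fun setT (fun t => norm2 (f t)).
Proof.
move=> mf.
by apply: (measurableT_comp (f := @Num.sqrt R) _ (measurable_dotp _ _ _ mf mf));
  apply: continuous_measurable_fun; exact: sqrt_continuous.
Qed.

Lemma measurable_rVZ d s (f : T -> 'rV[R]_d) : measurable_fun setT f ->
  measurable_fun setT (fun t => s *: f t).
Proof.
move=> mf; apply: measurable_fun_rV => i; rewrite /comp /rV_coord.
under eq_fun do rewrite mxE.
by apply: measurable_funM => //; exact: measurable_rV_coordE.
Qed.

Lemma measurable_maxaffineD d m (a : 'I_m.+1 -> 'rV[R]_d) b x (f : T -> 'rV[R]_d) :
  measurable_fun setT f ->
  measurable_fun setT (fun t => maxaffine a b (x + f t)).
Proof.
move=> mf; have mF i : measurable_fun setT (fun t => dotp (a i) (x + f t) + b 0 i).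
  under eq_fun do rewrite dotpDr.
  by apply: measurable_funD => //; apply: measurable_funD => //; exact: measurable_dotp.
(* Induction on the list of indices; the empty list yields the default value of the maximum, the
   piece of index [ord0]. *)
rewrite /maxaffine /fmax; elim: (index_enum _) => [|i s IHs].
  by under eq_fun do rewrite big_nil; exact: mF.
by under eq_fun do rewrite big_cons; exact: measurable_maxr.
Qed.

End measurability.

(** * Lebesgue integrals under dilations *)

Section scaling.
Context {R : realType}.
Local Open Scope ereal_scope.

(** [s] times the image of Lebesgue measure under x -> s x gives each interval ]a, b] its length, so
    by uniqueness it is Lebesgue measure. *)
Lemma ge0_integral_scale (s : R) (g : R -> \bar R) : (0 < s)%R ->
  measurable_fun setT g -> (forall x, 0 <= g x) ->
  \int[lebesgue_measure]_x g (s * x)%R =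
  (s^-1)%:E * \int[lebesgue_measure]_x g x.
Proof.
move=> s0 mg g0; have s0' := ltW s0.
have ms : measurable_fun setT ( *%R s : measurableTypeR R -> measurableTypeR R).
  exact: measurable_funM.
have scaled A : measurable A -> @lebesgue_measure R A =
    mscale (NngNum s0') (pushforward lebesgue_measure
      ( *%R s : measurableTypeR R -> measurableTypeR R)) A.
  move=> mA; apply: lebesgue_measure_unique => // _ [[a b]] _ <-/=.
  rewrite /mscale/= /pushforward.
  have -> : *%R s @^-1` `]a, b] = `](a / s)%R, (b / s)%R]%classic.
    apply/seteqP; split => x /=; rewrite !in_itv/=;
      by rewrite ltr_pdivrMr// ler_pdivlMr// mulrC.
  rewrite !lebesgue_measure_itv/= !lte_fin ltr_pM2r ?invr_gt0//.
  case: ifPn => _; last by rewrite mule0.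
  by rewrite -!EFinB -EFinM -mulrBl mulrC divfK// gt_eqF.
rewrite [in RHS](eq_measure_integral (mscale (NngNum s0')
  (pushforward lebesgue_measure
      ( *%R s : measurableTypeR R -> measurableTypeR R)))); last first.
  by move=> A mA _; exact: scaled.
rewrite ge0_integral_mscale//= muleA -EFinM mulVf ?gt_eqF// mul1e.
by rewrite ge0_integral_pushforward.
Qed.

Lemma ge0_integral_lebesgue_rVS n (g : 'rV[R]_n.+1 -> \bar R) :
  measurable_fun setT g -> (forall x, 0 <= g x) ->
  \int[lebesgue_rV R n.+1]_x g x =
  \int[lebesgue_measure]_x \int[lebesgue_rV R n]_v g (rV_cons (x, v)).
Proof.
move=> mg g0.
have mcons : measurable_fun setT
    (@rV_cons R n : measurableTypeR R * 'rV[R]_n -> 'rV[R]_n.+1).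
  exact: measurable_rV_cons.
rewrite [LHS](ge0_integral_pushforward mcons
  (lebesgue_measure \x lebesgue_rV R n))//= preimage_setT.
by rewrite fubini_tonelli1//=; exact: measurableT_comp mg mcons.
Qed.

Lemma rV_consZ n (s : R) (p : R * 'rV[R]_n) :
  (s *: rV_cons p = rV_cons (s * p.1, s *: p.2))%R.
Proof.
apply/rowP => i; rewrite mxE; case: (unliftP ord0 i) => [j ->|->].
  by rewrite !rV_consS mxE.
by rewrite !rV_cons0.
Qed.

(** Induction on the dimension through Tonelli: the induction hypothesis rescales the inner
    integral, the one-dimensional case the first coordinate. *)
Lemma ge0_integral_scale_rV n (s : R) (g : 'rV[R]_n -> \bar R) : (0 < s)%R ->
  measurable_fun setT g -> (forall x, 0 <= g x) ->
  \int[lebesgue_rV R n]_x g (s *: x)%R =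
  ((s^-1) ^+ n)%:E * \int[lebesgue_rV R n]_x g x.
Proof.
move=> s0; elim: n g => [|n IHn] g mg g0.
  rewrite expr0 mul1e; apply: eq_integral => x _.
  by rewrite (thinmx0 x) (thinmx0 (_ *: _)%R).
have mgc : measurable_fun setT (fun p => g (rV_cons p)).
  exact: measurableT_comp mg (@measurable_rV_cons R n).
rewrite !ge0_integral_lebesgue_rVS//; last first.
  exact: measurableT_comp mg (measurable_rVZ _ _ _ _).
under eq_integral => x _.
  under eq_integral do rewrite rV_consZ/=.
  rewrite (IHn (fun v => g (rV_cons ((s * x)%R, v))))//; last first.
    by apply: measurableT_comp mgc _; exact: measurable_pair1.
  over.
pose G (x : R) := \int[lebesgue_rV R n]_v g (rV_cons (x, v)).
have mG : measurable_fun setT G.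
  exact: (measurable_fun_fubini_tonelli_F (m2 := lebesgue_rV R n) _ mgc).
have G0 x : 0 <= G x by exact: integral_ge0.
rewrite ge0_integralZl ?lee_fin ?exprn_ge0 ?invr_ge0 ?(ltW s0)//=.
- by rewrite (ge0_integral_scale _ G)// muleA -EFinM -exprSr.
- by apply: (measurableT_comp (f := G)) => //; exact: measurable_funM.
- by move=> x _; exact: G0.
Qed.

End scaling.

(** * Integration against a density *)

Section density.
Context {d : measure_display} {T : measurableType d} {R : realType}.
Local Open Scope ereal_scope.

(** [h] and the Radon-Nikodym derivative of [nu] have the same integral over every measurable set,
    hence agree almost everywhere. *)
Lemma ge0_integral_density (mu : {sigma_finite_measure set T -> \bar R})
    (nu : {finite_measure set T -> \bar R}) (h f : T -> \bar R) :
  measurable_fun setT h -> (forall x, 0 <= h x) ->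
  (forall A, measurable A -> nu A = \int[mu]_(x in A) h x) ->
  measurable_fun setT f -> (forall x, 0 <= f x) ->
  \int[nu]_x f x = \int[mu]_x (f x * h x).
Proof.
move=> mh h0 nuE mf f0.
have numu : nu `<< mu.
  apply/null_content_dominatesP => A mA muA.
  by rewrite nuE// null_set_integral//; exact: measurable_funTS.
rewrite -(Radon_Nikodym_SigmaFinite.change_of_variables numu)//.
have mg := Radon_Nikodym_SigmaFinite.f_integrable numu.
apply: ge0_ae_eq_integral => //.
- by apply: emeasurable_funM => //; exact: measurable_int mg.
- exact: emeasurable_funM.
- by move=> x _; rewrite mule_ge0// Radon_Nikodym_SigmaFinite.f_ge0.
- by move=> x _; rewrite mule_ge0.
apply: ae_eqe_mul2l; apply: integral_ae_eq => // E _ mE.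
by rewrite -nuE// (Radon_Nikodym_SigmaFinite.f_integral numu).
Qed.

End density.

(** * First moment of the unnormalized density exp(-lam |x|) *)

Section moment.
Context {R : realType}.

Lemma bernoulli_ge (e : R) n : 0 <= e <= 1 -> 1 - n%:R * e <= (1 - e) ^+ n.
Proof.
move=> /andP[e0 e1]; elim: n => [|n IHn]; first by rewrite mul0r subr0 expr0.
rewrite exprS (le_trans _ (ler_wpM2l _ IHn)) ?subr_ge0//.
rewrite -natr1 -subr_ge0 (_ : _ - _ = n%:R * e ^+ 2); last by ring.
by rewrite mulr_ge0 ?sqr_ge0.
Qed.

(** Replaces the limit e -> 0 by one explicit e. *)
Lemma le_of_lt1_linear (a b k : R) :
  (forall e, 0 < e < 1 -> a <= b + e * k) -> a <= b.
Proof.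
move=> ab; rewrite leNgt; apply/negP => ba.
pose u := a - b; have u0 : 0 < u by rewrite subr_gt0.
(* Chosen so that 0 < e < 1 and e |k| < u = a - b, which contradicts the hypothesis at e. *)
pose e := u / (u + `|k| + 1).
have den0 : 0 < u + `|k| + 1 by rewrite ltr_wpDl ?ltr01// addr_ge0// ltW.
have e0 : 0 < e by rewrite divr_gt0.
have e1 : e < 1.
  by rewrite ltr_pdivrMr// mul1r -addrA ltrDl ltr_wpDl.
have /ab : 0 < e < 1 by rewrite e0.
apply/negP; rewrite -ltNge -ltrBrDl -/u (le_lt_trans (ler_norm _))//.
rewrite normrM (gtr0_norm e0) mulrAC ltr_pdivrMr// ltr_pM2l//.
by rewrite addrAC ltrDr ltr_wpDl// ltW.
Qed.

Local Open Scope ereal_scope.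

Lemma integral_norm2_expR n (lam : R) : (0 < lam)%R ->
  let I := \int[lebesgue_rV R n]_x (expR (- (lam * norm2 x)))%:E in
  I < +oo ->
  \int[lebesgue_rV R n]_x (norm2 x * expR (- (lam * norm2 x)))%:E
    <= (n%:R / lam)%:E * I.
Proof.
move=> lam0 I Ioo; set J := (X in X <= _).
have mnorm : measurable_fun setT (@norm2 R n) by exact: (measurable_norm2 _ id).
have mE : measurable_fun setT (fun x : 'rV[R]_n => expR (- (lam * norm2 x))).
  by apply: measurableT_comp => //; apply: measurableT_comp => //;
    exact: measurable_funM.
have I0 : 0 <= I by apply: integral_ge0 => x _; rewrite lee_fin expR_ge0.
have J0 : 0 <= J.
  by apply: integral_ge0 => x _; rewrite lee_fin mulr_ge0 ?norm2_ge0 ?expR_ge0.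
(* Stated in the extended reals, because [J] is not yet known to be finite. *)
have key (e : R) : (0 < e < 1)%R ->
    I + (lam * e)%:E * J <= ((1 - e)^-1 ^+ n)%:E * I.
  move=> /andP[e0 e1].
  rewrite -(ge0_integral_scale_rV _ _ (fun x => (expR (- (lam * norm2 x)))%:E));
    [|by rewrite subr_gt0|exact/measurable_EFinP
     |by move=> x; rewrite lee_fin expR_ge0].
  rewrite -ge0_integralZl//=; last 3 first.
  - by apply/measurable_EFinP; exact: measurable_funM.
  - by move=> x _; rewrite lee_fin mulr_ge0 ?norm2_ge0 ?expR_ge0.
  - by rewrite lee_fin mulr_ge0 ?ltW.
  rewrite -ge0_integralD//=; last 3 first.
  - exact/measurable_EFinP.
  - by move=> x _; rewrite lee_fin !mulr_ge0 ?norm2_ge0 ?expR_ge0 ?ltW.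
  - by apply/measurable_EFinP; do 2 apply: measurable_funM => //.
  apply: ge0_le_integral => //=.
  - by move=> x _; rewrite lee_fin addr_ge0 ?mulr_ge0 ?norm2_ge0 ?expR_ge0 ?ltW.
  - by apply/measurable_EFinP; apply: measurable_funD => //;
      do 2 apply: measurable_funM => //.
  - apply/measurable_EFinP; apply: (measurableT_comp mE).
    exact: (measurable_rVZ _ _ id).
  move=> x _; rewrite lee_fin norm2Z ?subr_ge0 ?(ltW e1)//.
  (* Splitting the exponent factors out exp(-lam |x|) and leaves 1 + v <= exp v at v = lam e |x|. *)
  rewrite (_ : (- (lam * ((1 - e) * norm2 x)) =
    lam * e * norm2 x - lam * norm2 x)%R); last by ring.
  rewrite expRD mulrA -[X in (X + _)%R]mul1r -mulrDl ler_wpM2r ?expR_ge0//.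
  exact: expR_ge1Dx.
have Ifin : I \is a fin_num by rewrite ge0_fin_numE.
(* At e = 1/2 the right side of [key] is finite, whereas an infinite [J] would make the left side
   infinite. *)
have Jfin : J \is a fin_num.
  rewrite ge0_fin_numE// ltey; apply/eqP => Joo.
  have half : (0 < (2^-1 : R) < 1)%R by lra.
  have := key _ half; rewrite Joo gt0_muley ?lte_fin ?mulr_gt0 ?invr_gt0//.
  by rewrite -(fineK Ifin) -EFinM.
move: key; rewrite -(fineK Ifin) -(fineK Jfin).
set i := fine I; set j := fine J => key.
have i0 : (0 <= i)%R by exact: fine_ge0.
have j0 : (0 <= j)%R by exact: fine_ge0.
rewrite -EFinM lee_fin mulrAC ler_pdivlMr//.
apply: (le_of_lt1_linear _ _ (n%:R * (lam * j))) => e e01.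
have := key e e01; rewrite -!EFinM -EFinD lee_fin exprVn.
move: e01 => /andP[e0 e1].
rewrite ler_pdivlMl ?exprn_gt0 ?subr_gt0// => ij.
have : ((1 - n%:R * e) * (i + lam * e * j) <= i)%R.
  apply: le_trans ij; rewrite ler_wpM2r ?addr_ge0 ?mulr_ge0 ?(ltW lam0) ?(ltW e0)//.
  by rewrite bernoulli_ge// !ltW.
(* The terms in [i] without a factor e cancel, so one factor e can be divided out. *)
rewrite -subr_ge0 (_ : (_ - _ = e * (n%:R * i + e * (n%:R * (lam * j)) - j * lam))%R);
  last by ring.
by rewrite pmulr_rge0// subr_ge0.
Qed.

End moment.

(** * From the moment bound to the expected gap *)

Lemma integral_le_ge0 {disp : measure_display} {T : measurableType disp}
    {R : realType} (mu : {measure set T -> \bar R}) (f g : T -> \bar R) :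
  measurable_fun setT f -> measurable_fun setT g -> (forall x, 0 <= g x)%E ->
  (forall x, f x <= g x)%E -> (\int[mu]_x f x <= \int[mu]_x g x)%E.
Proof.
(* No sign is imposed on [f], since the noisy point may leave [P] and fall below the constrained
   minimum; dropping the negative part only increases the integral. *)
move=> mf mg g0 fg; rewrite integralE (@le_trans _ _ (\int[mu]_x f^\+ x)%E)//.
  by rewrite geeDl ?oppe_le0 ?integral_ge0.
apply: ge0_le_integral => //; first exact: measurable_funepos.
by move=> x _; rewrite funeposE ge_max g0 fg.
Qed.

Theorem theorem17 (R : realType) (d m : nat)
  (P : set 'rV[R]_d) (hP : polytope P) (P0 : P !=set0)
  (a : 'I_m.+1 -> 'rV[R]_d)
  (xopt : 'rV[R]_m.+1 -> 'rV[R]_d)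
  (hxopt : forall b : 'rV[R]_m.+1, minimizer P (maxaffine a b) (xopt b))
  (bmax : R) (bmax0 : 0 < bmax)
  (Delta : R) (hDelta : sensitivity bmax xopt = Delta%:E) (Delta0 : 0 < Delta)
  (eps : R) (eps0 : 0 < eps)
  (disp : measure_display) (T : measurableType disp) (Pr : probability T R)
  (w : {RV Pr >-> 'rV[R]_d})
  (hw : density_proportional_to w
    (fun x : 'rV[R]_d => expR (- (eps * norm2 x / (Num.sqrt d%:R * Delta)))))
  (D : 'rV[R]_m.+1) :
  let f := maxaffine a D in
  let M_S : T -> 'rV[R]_d := fun t => xopt D + w t in
  let G := fmax (fun i => norm2 (a i)) in
  ('E_Pr[fun t => (f (M_S t) - f (xopt D))%R]
    <= (G * d%:R `^ (3 / 2) * Delta / eps)%:E)%E.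

Proof.
lazy zeta; set G := fmax _; rewrite unlock.
(* For d = 0 the quotient defining [lam] has denominator 0; there the space is a single point and
   both sides vanish. *)
have [d0|d0] := posnP d.
  subst d; rewrite integral0_eq.
    by rewrite powR0 ?mulr0 ?mul0r.
  by move=> t _; rewrite (thinmx0 (_ + _)) (thinmx0 (xopt D)) subrr.
set lam := eps / (Num.sqrt d%:R * Delta).
have sd0 : 0 < Num.sqrt d%:R :> R by rewrite sqrtr_gt0 ltr0n.
have lam0 : 0 < lam by rewrite divr_gt0 ?mulr_gt0.
have lamE x : expR (- (eps * norm2 x / (Num.sqrt d%:R * Delta)))
    = expR (- (lam * norm2 x)) :> R by rewrite mulrAC.
case: hw => c c0 dens.
have G0 : 0 <= G by rewrite (le_trans (norm2_ge0 _ (a ord0)))// le_fmax.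
have mw : measurable_fun setT (w : T -> 'rV[R]_d) by [].
have mnorm : measurable_fun setT (@norm2 R d) by exact: (measurable_norm2 _ id).
have mE : measurable_fun setT (fun x : 'rV[R]_d => expR (- (lam * norm2 x))).
  by apply: measurableT_comp => //; apply: measurableT_comp => //;
    exact: measurable_funM.
pose I := (\int[lebesgue_rV R d]_x (expR (- (lam * norm2 x)))%:E)%E.
(* Total mass one fixes the normalizing constant, and it also forces [I] to be finite. *)
have cI : (c%:E * I = 1)%E.
  have := dens setT measurableT; rewrite probability_setT => ->.
  under eq_integral do rewrite lamE EFinM.
  by rewrite ge0_integralZl ?lee_fin ?(ltW c0)//; exact/measurable_EFinP.
have Ioo : (I < +oo)%E.
  rewrite ltey; apply/eqP => Ioo; move: cI.
  by rewrite Ioo gt0_muley ?lte_fin.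
apply: (@le_trans _ _ (\int[Pr]_t (G * norm2 (w t))%:E)%E).
  apply: integral_le_ge0 => [||t|t].
  - apply/measurable_EFinP; apply: measurable_funB => //.
    exact: measurable_maxaffineD.
  - by apply/measurable_EFinP; apply: measurable_funM => //;
      exact: measurable_norm2.
  - by rewrite lee_fin mulr_ge0 ?norm2_ge0.
  - by rewrite lee_fin maxaffine_lip.
(* The expectation moves to the law of [w], then to a Lebesgue integral against its density. *)
rewrite -(@ge0_integral_distribution _ _ _ _ _ _ w
  (fun x => (G * norm2 x)%:E)); last 2 first.
  by apply/measurable_EFinP; exact: measurable_funM.
  by move=> x; rewrite lee_fin mulr_ge0 ?norm2_ge0.
rewrite (ge0_integral_density (lebesgue_rV R d) _
    (fun x : 'rV[R]_d => (c * expR (- (lam * norm2 x)))%:E)); last 5 first.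
- by apply/measurable_EFinP; exact: measurable_funM.
- by move=> x; rewrite lee_fin mulr_ge0 ?expR_ge0 ?ltW.
- by move=> A mA; rewrite [LHS]dens//; apply: eq_integral => x _; rewrite lamE.
- by apply/measurable_EFinP; exact: measurable_funM.
- by move=> x; rewrite lee_fin mulr_ge0 ?norm2_ge0.
under eq_integral => x _.
  rewrite -EFinM mulrACA EFinM; over.
rewrite ge0_integralZl//; last 3 first.
- by apply/measurable_EFinP; exact: measurable_funM.
- by move=> x _; rewrite lee_fin mulr_ge0 ?norm2_ge0 ?expR_ge0.
- by rewrite lee_fin mulr_ge0 ?(ltW c0).
apply: le_trans (lee_wpmul2l _ (integral_norm2_expR _ _ lam0 Ioo)) _.
  by rewrite lee_fin mulr_ge0 ?(ltW c0).
(* With c I = 1 the bound is G d / lam, and d / lam = d sqrt(d) Delta / eps; it remains to write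
   d^(3/2) as d sqrt(d). *)
rewrite -/I EFinM -muleA (muleCA c%:E) cI mule1 -EFinM lee_fin.
rewrite (_ : 3 / 2 = 1 + 2^-1); last by field.
rewrite powRD; last by rewrite gt_eqF// addr_gt0.
rewrite powRr1// powR12_sqrt// /lam invf_div.
rewrite le_eqVlt; apply/orP; left; apply/eqP; field.
by rewrite gt_eqF.
Qed.
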